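(* Let $K$ be a nonempty compact Hausdorff space and let $\Phi$ be a closed subspace of $\mathcal{C}(K)$ which separates points of $K$ and contains the constant functions. For every $f\in\mathcal{C}(K)$ there exists a convex $w^{*}$-continuous function $F_f:(K(\Phi),w^{*})\to\mathbb{R}$ such that: (i) $\widehat{f}=F_f\circ\delta^{\Phi}$ (therefore $\widehat f\in T\mathcal{C}(K,\Phi)$); (ii) $-(\|f\|_\infty+1)\le F_f(Q)\le \|f\|_\infty$ for all $Q\in K(\Phi)$.
   Context: $\mathcal{C}(K)$ is the Banach space of continuous real-valued functions on $K$ with the sup-norm; its dual $\mathcal{C}(K)^*$ is identified with the (signed) Radon measures on $K$ via $\langle\mu,f\rangle=\int_K f\,d\mu$. $\mathcal{M}^1(K)$ is the set of Borel (Radon) probability measures on $K$. $\delta_x$ is the Dirac measure at $x$. $w^*$ denotes the weak-star topology. $K(\Phi):=\{Q\in\Phi^*:\ \|Q\|=\langle Q,\mathbf 1\rangle=1\}$, where $\mathbf 1$ is the constant function $1$; it is a convex $w^*$-compact subset of $\Phi^*$. The canonical injection $\delta^\Phi:K\to (K(\Phi),w^* )$ is $\delta^\Phi(x)(\phi)=\phi(x)$ for $\phi\in\Phi$. Equivalence relation on $\mathcal{C}(K)^*$: $\mu\sim\mu'$ iff $\langle\mu,\phi\rangle=\langle\mu',\phi\rangle$ for all $\phi\in\Phi$; $[\mu]$ denotes the class of $\mu$. For $f\in\mathcal{C}(K)$ and $\mu\in\mathcal{M}^1(K)$ put $\mathcal{W}_{\mu,f}:=\{\nu\in\mathcal{C}(K)^*:\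 |\langle\nu-\mu,f\rangle|<1\}$ and let $\mathcal{O}_f:=\mathrm{co}\left(\bigcup_{\mu\in\mathcal{M}^1(K)}\mathcal{W}_{\mu,f}\right)$ (convex hull). The function $\widehat f:K\to\mathbb{R}$ is defined by $\widehat f(x)=\inf_{\mu\in[\delta_x]\cap\mathcal{O}_f}\int_K f\,d\mu$. $T\mathcal{C}(K,\Phi)$ (continuous convex-trace functions) is the set of functions $g:K\to\mathbb{R}$ of the form $g=F\circ\delta^\Phi$ with $F:K(\Phi)\to\mathbb{R}$ convex and $w^*$-continuous. *)

(* Defs.v *)
From HB Require Import structures.
From mathcomp Require Import all_boot all_order all_algebra.
From mathcomp Require Import all_classical all_reals all_analysis.
From mathcomp Require Import measurable_realfun.

Set Implicit Arguments.
Unset Strict Implicit.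
Unset Printing Implicit Defensive.

Import Order.TTheory GRing.Theory Num.Theory.
Import numFieldNormedType.Exports.

Local Open Scope classical_set_scope.
Local Open Scope ring_scope.

Section continuous_functions.
Context (R : realType) (K : topologicalType).

Definition continuousp : {pred K -> R^o} := fun f => `[< continuous f >].

Lemma continuousp_submod_closed : submod_closed continuousp.
Proof.
split; first by apply/asboolP => x; exact: cvg_cst.
move=> a f g /asboolP fc /asboolP gc; apply/asboolP => x.
by apply: cvgD; [apply: cvgZl_tmp; exact: fc | exact: gc].
Qed.

HB.instance Definition _ :=
  GRing.isSubmodClosed.Build R (K -> R^o) continuousp continuousp_submod_closed.

End continuous_functions.

(* The compactness proof is a phantom argument that makes the sup-norm below a
   norm. *)
Definition contfun (R : realType) (K : topologicalType)
    (hK : compact [set: K]) : Type := {f : K -> R^o | f \in @continuousp R K}.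

Section contfun_normed.
Context (R : realType) (K : topologicalType) (hK : compact [set: K]).
Local Notation C := (@contfun R K hK).

HB.instance Definition _ := SubChoice.on C.
HB.instance Definition _ := [SubChoice_isSubLmodule of C by <:].

Definition contfun_val (f : C) : K -> R := val f.
Coercion contfun_val : contfun >-> Funclass.

Lemma contfun_continuous (f : C) : continuous (f : K -> R^o).
Proof. exact: (asboolP _ (valP f)). Qed.

Lemma contfun_has_ubound (f : C) : has_ubound [set `|f x| | x in [set: K]].
Proof.
have /compact_bounded[M [_ fM]] : compact ((f : K -> R^o) @` [set: K]).
  apply: continuous_compact => //; apply: continuous_subspaceT.
  exact: contfun_continuous.
exists (M + 1) => _ [x _ <-].
by apply: (fM (M + 1)); [rewrite ltrDl | exists x].
Qed.

Definition supnorm (f : C) : R := sup [set `|f x| | x in [set: K]].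

Lemma le_supnorm (f : C) (x : K) : `|f x| <= supnorm f.
Proof. by apply: ub_le_sup; [exact: contfun_has_ubound | exists x]. Qed.

Lemma supnorm_le (f : C) (M : R) :
  0 <= M -> (forall x, `|f x| <= M) -> supnorm f <= M.
Proof.
move=> M0 fM; rewrite /supnorm.
have [->|/set0P S0] := eqVneq [set `|f x| | x in [set: K]] set0.
  by rewrite sup0.
by apply: ge_sup => // _ [x _ <-].
Qed.

Lemma supnorm_ge0 (f : C) : 0 <= supnorm f.
Proof.
rewrite /supnorm; have [->|/set0P[_ [x _ _]]] :=
  eqVneq [set `|f x| | x in [set: K]] set0; first by rewrite sup0.
exact: le_trans (normr_ge0 _) (le_supnorm f x).
Qed.

Lemma supnormD (f g : C) : supnorm (f + g) <= supnorm f + supnorm g.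
Proof.
apply: supnorm_le => [|x]; first by rewrite addr_ge0 ?supnorm_ge0.
by rewrite (le_trans (ler_normD _ _))// lerD ?le_supnorm.
Qed.

Lemma supnormZ_le (a : R) (f : C) : supnorm (a *: f) <= `|a| * supnorm f.
Proof.
apply: supnorm_le => [|x]; first by rewrite mulr_ge0 ?supnorm_ge0.
rewrite [X in `|X|](_ : _ = a * f x)//.
by rewrite normrM ler_wpM2l ?le_supnorm.
Qed.

Lemma supnormZ (a : R) (f : C) : supnorm (a *: f) = `|a| * supnorm f.
Proof.
apply/eqP; rewrite eq_le supnormZ_le /=.
have [->|a0] := eqVneq a 0; first by rewrite normr0 mul0r supnorm_ge0.
rewrite -ler_pdivlMl ?normr_gt0// -normfV.
by rewrite -{1}[f](scalerK a0) supnormZ_le.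
Qed.

Lemma supnorm0_eq0 (f : C) : supnorm f = 0 -> f = 0.
Proof.
move=> f0; apply: val_inj; apply/funext => x.
by apply/eqP; rewrite -normr_le0 -f0; exact: le_supnorm.
Qed.

HB.instance Definition _ :=
  @Lmodule_isNormed.Build R C supnorm supnormD supnormZ supnorm0_eq0.

Lemma cst_continuousp (c : R) : (cst c : K -> R^o) \in @continuousp R K.
Proof. by apply/asboolP => x; exact: cvg_cst. Qed.

Definition contfun_cst (c : R) : C := Sub (cst c : K -> R^o) (cst_continuousp c).

End contfun_normed.

Section subspace.
Context (R : realType) (V : normedModType R) (S : submodClosed V).

Definition normed_subspace : Type := {v : V | v \in S}.

HB.instance Definition _ := SubChoice.on normed_subspace.
HB.instance Definition _ := [SubChoice_isSubLmodule of normed_subspace by <:].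

Let subnorm (v : normed_subspace) : R := `|val v|.

Let subnormD v w : subnorm (v + w) <= subnorm v + subnorm w.
Proof. exact: ler_normD. Qed.

Let subnormZ (a : R) v : subnorm (a *: v) = `|a| * subnorm v.
Proof. exact: normrZ. Qed.

Let subnorm0_eq0 v : subnorm v = 0 -> v = 0.
Proof. by move=> /normr0_eq0 v0; exact: val_inj. Qed.

HB.instance Definition _ :=
  @Lmodule_isNormed.Build R normed_subspace subnorm subnormD subnormZ
    subnorm0_eq0.

End subspace.

Section dual.
Context (R : realType) (V : normedModType R).

Definition dualp : {pred V -> R^o} :=
  fun Q => `[< linear Q /\ continuous Q >].

Lemma dualp_submod_closed : submod_closed dualp.
Proof.
split.
  apply/asboolP; split; last by move=> x; exact: cvg_cst.
  by move=> a u v; rewrite /= scaler0 addr0.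
move=> a P Q /asboolP[Pl Pc] /asboolP[Ql Qc]; apply/asboolP; split.
  move=> b u v.
  have E w : (a *: P + Q) w = a *: P w + Q w by [].
  by rewrite !E Pl Ql !scalerDr !scalerA (mulrC a b) addrACA.
by move=> x; apply: cvgD; [apply: cvgZl_tmp; exact: Pc | exact: Qc].
Qed.

HB.instance Definition _ :=
  GRing.isSubmodClosed.Build R (V -> R^o) dualp dualp_submod_closed.

Definition dual : Type := {Q : V -> R^o | Q \in dualp}.

HB.instance Definition _ := SubChoice.on dual.
HB.instance Definition _ := [SubChoice_isSubLmodule of dual by <:].

Definition dual_val (Q : dual) : V -> R^o := val Q.
Coercion dual_val : dual >-> Funclass.

Lemma dual_linear (Q : dual) : linear Q.
Proof. by have /asboolP[] := valP Q. Qed.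

Lemma dual_continuous (Q : dual) : continuous Q.
Proof. by have /asboolP[] := valP Q. Qed.

HB.instance Definition _ (Q : dual) :=
  GRing.isLinear.Build R V R^o *:%R (dual_val Q) (dual_linear Q).

(* The topology put on the dual is the weak-star one, not that of the operator
   norm. *)
HB.instance Definition _ := Topological.copy dual
  (initial_topology (dual_val : dual -> {ptws V -> R^o})).

Definition dual_norm (Q : dual) : R :=
  sup [set `|Q v| | v in [set v : V | `|v| <= 1]].

End dual.

Definition convex_hull (R : numDomainType) (E : lmodType R) (A : set E) :
  set E := smallest (@convex_set R E) A.

Section radon_measures.
Context (R : realType) (K : ptopologicalType) (hK : compact [set: K]).

Definition borel : measurableType (@open K).-sigma :=
  g_sigma_algebraType (@open K).

(* Inner regularity; finiteness of mu is part of being a probability. *)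
Definition radon (mu : probability borel R) : Prop :=
  forall A : set borel, measurable A ->
    mu A = ereal_sup [set mu C | C in [set C : set K | compact C /\ C `<=` A]].

Lemma continuous_borel_measurable (f : K -> R^o) :
  continuous f -> measurable_fun [set: borel] (f : borel -> R).
Proof.
move=> /continuousP fc.
apply: (measurability _ (RGenOInfty.measurableE R)).
move=> _ [_ [a ->] <-]; rewrite setTI.
by apply: sub_sigma_algebra; apply: fc; exact: rray_open.
Qed.

Local Notation C := (contfun R hK).

Lemma contfun_integrable (mu : probability borel R) (f : C) :
  mu.-integrable [set: borel] (EFin \o (f : borel -> R)).
Proof.
apply: measurable_bounded_integrable => //.
- by rewrite [X in (X < _)%E](probability_setT mu) ltry.
- by apply: continuous_borel_measurable; exact: contfun_continuous.
- exists `|f|; split; first exact: num_real.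
  by move=> M fM x _; apply: le_trans (ltW fM); exact: le_supnorm.
Qed.

Definition integral_fun (mu : probability borel R) : C -> R^o :=
  fun f => \int[mu]_x f x.

Lemma integral_fun_dual (mu : probability borel R) :
  integral_fun mu \in @dualp R C.
Proof.
have lin : linear (integral_fun mu).
  move=> a; rewrite /integral_fun => f g.
  rewrite [X in _ = X + _](_ : _ = a * \int[mu]_x (f : C) x)//.
  rewrite -RintegralZl//; last exact: contfun_integrable.
  rewrite -RintegralD//; first exact: (contfun_integrable mu (a *: f)).
  exact: contfun_integrable.
apply/asboolP; split=> //.
pose Ladd := GRing.isLinear.Build R C R^o *:%R (integral_fun mu) lin.
pose L : {linear C -> R^o} := HB.pack (integral_fun mu) Ladd.
apply: (@bounded_linear_continuous _ _ _ L).
apply/bounded_funP => r; exists r => f fr.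
have fK x : `|(f : C) x| <= r by rewrite (le_trans _ fr)//; exact: le_supnorm.
rewrite (le_trans (le_normr_Rintegral _ (contfun_integrable mu f)))//.
have -> : r = \int[mu]_(x in [set: borel]) (cst r) x.
  by rewrite Rintegral_cst// [X in fine X](probability_setT mu) mulr1.
apply: le_Rintegral => //.
  by have /integrable_norm := contfun_integrable mu f.
exact: (contfun_integrable mu (contfun_cst hK r)).
Qed.

(* C(K)^* is the space of continuous linear functionals on C(K); a Borel
   measure mu enters it as f |-> int_K f dmu, so that the pairing <nu, f> is
   always the application nu f. *)
Definition measure_functional (mu : probability borel R) : dual C :=
  Sub (integral_fun mu) (integral_fun_dual mu).

End radon_measures.

Section convex_trace.
Context (R : realType) (K : ptopologicalType) (hK : compact [set: K]).
Local Notation C := (contfun R hK).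

Definition radon_probability : set (dual C) :=
  [set measure_functional hK mu | mu in [set mu | radon mu]].

Definition dirac_functional (x : K) : dual C :=
  measure_functional hK (\d_(x : borel K) : probability (borel K) R).

Lemma dirac_functionalE (x : K) (f : C) : dirac_functional x f = f x.
Proof.
rewrite [LHS]/(\int[\d_(x : borel K)]_y f y) /Rintegral integral_dirac//=.
  by rewrite indicT mul1r.
have /integrableP[] :=
  contfun_integrable (\d_(x : borel K) : probability (borel K) R) f.
by [].
Qed.

Definition slab (mu : dual C) (f : C) : set (dual C) :=
  [set nu : dual C | `|(nu - mu : dual C) f| < 1].

Definition slab_hull (f : C) : set (dual C) :=
  convex_hull (\bigcup_(mu in radon_probability) slab mu f).

Context (Phi : submodClosed C).

Definition equiv_mod (mu nu : dual C) : Prop :=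
  forall phi : C, phi \in Phi -> mu phi = nu phi.

Definition equiv_class (mu : dual C) : set (dual C) :=
  [set nu | equiv_mod mu nu].

Definition hat (f : C) : K -> R := fun x =>
  inf [set mu f | mu in equiv_class (dirac_functional x) `&` slab_hull f].

Definition evaluation (x : K) : normed_subspace Phi -> R^o :=
  fun phi => (val phi : C) x.

Lemma evaluation_dual (x : K) :
  evaluation x \in @dualp R (normed_subspace Phi).
Proof.
have lin : linear (evaluation x).
  move=> a; rewrite /evaluation => u v.
  have -> : val (a *: u + v) = a *: val u + val v by rewrite linearP.
  by [].
apply/asboolP; split=> //.
pose Ladd := GRing.isLinear.Build R (normed_subspace Phi) R^o *:%R
  (evaluation x) lin.
pose L : {linear normed_subspace Phi -> R^o} :=
  HB.pack (evaluation x) Ladd.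
apply: (@bounded_linear_continuous _ _ _ L).
apply/bounded_funP => r; exists r => phi phir.
by rewrite (le_trans _ phir)//; exact: le_supnorm.
Qed.

Definition injection (x : K) : dual (normed_subspace Phi) :=
  Sub (evaluation x) (evaluation_dual x).

Context (Phi1 : contfun_cst hK 1 \in Phi).

Definition subspace_one : normed_subspace Phi := Sub (contfun_cst hK 1) Phi1.

Definition state_space : set (dual (normed_subspace Phi)) :=
  [set Q | dual_norm Q = 1 /\ Q subspace_one = 1].

(* F is total on the dual of Phi, but only its restriction to state_space is
   constrained and used. *)
Definition convex_trace : set (K -> R) :=
  [set g | exists F : dual (normed_subspace Phi) -> R^o,
     [/\ convex_function state_space F,
         {within state_space, continuous F} &
         g = F \o injection]].

End convex_trace.

(* Main.v *)
From HB Require Import structures.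
Require Import Defs.
From mathcomp Require Import all_boot all_order all_algebra.
From mathcomp Require Import all_classical all_reals all_analysis.
From mathcomp Require Import lra.

Import Order.TTheory GRing.Theory Num.Theory.
Import numFieldNormedType.Exports.

Local Open Scope classical_set_scope.
Local Open Scope ring_scope.

(** Membership in O_f constrains a functional nu only through the number
    <nu, f>. Let m be the minimum of f on K. Every nu in O_f satisfies
    m - 1 < <nu, f>, because Radon probabilities integrate f to at least m and
    open half-spaces are convex; and every nu whose value at f is at distance
    less than 1 from m lies in O_f already through the Dirac measure at a
    minimum point. Two cases remain.

    If f is in Phi, every functional equivalent to delta_x gives f the value
    f x, and delta_x lies in O_f. Hence the envelope is f itself and is the
    trace of the affine function Q |-> Q f, which is weak-star continuous by
    the very definition of that topology and bounded by |f| on states since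
    these have norm 1 ([hat_subspace]).

    If f is not in Phi, then, Phi being closed, some continuous functional L on
    C(K) vanishes on Phi and equals 1 at f. The class of delta_x contains
    delta_x + t L for all real t, so its values at f fill the whole line and
    the infimum over O_f is m - 1 whatever x is: the envelope is the trace of a
    constant function ([hat_notin_subspace]).

    The functional L comes from the Hahn-Banach theorem
    ([sublinear_support]), applied to the distance to Phi. It is obtained not
    by extending linear functionals but by descending among sublinear ones: a
    minimal sublinear functional is linear. *)

(** * Sublinear functionals *)

Section sublinear.
Context {R : realType} {V : lmodType R}.
Implicit Types (p q : V -> R) (x y v : V).

Definition sublinear q :=
  (forall x y, q (x + y) <= q x + q y) /\
  (forall (a : R) x, 0 <= a -> q (a *: x) <= a * q x).

Lemma sublinear0 q : sublinear q -> q 0 = 0.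
Proof.
move=> [qD qZ]; have := qD 0 0; have := qZ 0 0 (lexx _).
by rewrite scale0r addr0 mul0r; lra.
Qed.

Lemma sublinearZ q (a : R) x : sublinear q -> 0 <= a -> q (a *: x) = a * q x.
Proof.
move=> qs; rewrite le_eqVlt => /predU1P[<-|a0].
  by rewrite scale0r mul0r sublinear0.
case: qs => _ qZ; apply/eqP; rewrite eq_le qZ ?(ltW a0)//=.
rewrite -(ler_pdivlMl _ _ a0) -{1}[x](scalerK (lt0r_neq0 a0)).
by apply: qZ; rewrite invr_ge0 ltW.
Qed.

Lemma sublinear_geN q x : sublinear q -> - q (- x) <= q x.
Proof.
move=> qs; have := qs.1 x (- x); rewrite subrr sublinear0//; lra.
Qed.

(** The three infima below, over a chain of functionals, over the multiples of
    a vector and over the points of a subspace, are sublinear for this one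
    reason: the family need not consist of sublinear functions, as long as its
    index may change when vectors are added or scaled. *)
Lemma sublinear_inf (I : Type) (D : set I) (G : I -> V -> R) :
    D !=set0 -> (forall x, has_lbound [set G i x | i in D]) ->
    (forall i j x y, D i -> D j ->
       exists2 k, D k & G k (x + y) <= G i x + G j y) ->
    (forall i (a : R) x, D i -> 0 <= a ->
       exists2 k, D k & G k (a *: x) <= a * G i x) ->
  sublinear (fun x => inf [set G i x | i in D]).
Proof.
move=> D0 lbG GD GZ; set q := fun x => _.
have ge_q i x : D i -> q x <= G i x by move=> Di; apply: ge_inf => //; exists i.
have le_q z x : (forall i, D i -> z <= G i x) -> z <= q x.
  by move=> zG; apply: lb_le_inf; [exact: image_nonempty|move=> _ [i /zG ? <-]].
split=> [x y|a x a0].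
  rewrite -lerBlDr; apply: (le_q) => i Di.
  rewrite lerBlDr -lerBlDl; apply: (le_q) => j Dj.
  have [k Dk] := GD i j x y Di Dj; have := ge_q k (x + y) Dk; lra.
have step i : D i -> q (a *: x) <= a * G i x.
  by move=> Di; have [k Dk] := GZ i a x Di a0; apply: le_trans; exact: ge_q.
move: a0; rewrite le_eqVlt => /predU1P[a0|a0].
  by case: D0 => i /step; rewrite -a0 !mul0r.
rewrite -(ler_pdivrMl _ _ a0); apply: (le_q) => i Di.
by rewrite ler_pdivrMl// step.
Qed.

(** The largest sublinear functional below [q] whose value at [- v] is at most
    [- q v]: homogeneity and subadditivity force the bound
    [q (x + t *: v) - t * q v] on it for every [t >= 0]. *)
Definition shear q v : V -> R := fun x =>
  inf [set q (x + t *: v) - t * q v | t in [set t : R | 0 <= t]].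

Lemma has_lbound_shear q v x : sublinear q ->
  has_lbound [set q (x + t *: v) - t * q v | t in [set t : R | 0 <= t]].
Proof.
move=> qs; exists (- q (- x)) => _ [t /= t0 <-].
have := qs.1 (x + t *: v) (- x).
by rewrite addrAC subrr add0r (sublinearZ _ _ _ qs t0); lra.
Qed.

Lemma shear_le q v (t : R) x : sublinear q -> 0 <= t ->
  shear q v x <= q (x + t *: v) - t * q v.
Proof. by move=> qs t0; apply: ge_inf; [exact: has_lbound_shear|exists t]. Qed.

Lemma sublinear_shear q v : sublinear q -> sublinear (shear q v).
Proof.
move=> qs; apply: (sublinear_inf _ _ (fun t x => q (x + t *: v) - t * q v)).
- by exists 0 => /=.
- by move=> x; exact: has_lbound_shear.
- move=> s t x y /= s0 t0; exists (s + t); first exact: addr_ge0.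
  by rewrite scalerDl addrACA; have := qs.1 (x + s *: v) (y + t *: v); lra.
- move=> t a x /= t0 a0; exists (a * t); first exact: mulr_ge0.
  by rewrite -scalerA -scalerDr sublinearZ// mulrBr mulrA.
Qed.

Lemma shear_self q v x : sublinear q -> shear q v x <= q x.
Proof.
by move=> qs; apply: le_trans (shear_le _ _ _ _ qs (lexx 0)) _;
  rewrite scale0r addr0 mul0r subr0.
Qed.

Lemma shearN q v : sublinear q -> shear q v (- v) <= - q v.
Proof.
move=> qs; apply: le_trans (shear_le _ _ _ _ qs ler01) _.
by rewrite scale1r addNr sublinear0// mul1r sub0r.
Qed.

(** Zorn's lemma applies since the pointwise infimum of a chain of sublinear
    functionals below [p] is finite, each of them being at least
    [- p (- x)] at [x]. *)
Lemma minimal_sublinear p : sublinear p ->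
  exists q, [/\ sublinear q, forall x, q x <= p x &
    forall r, sublinear r -> (forall x, r x <= q x) -> r = q].
Proof.
move=> ps.
pose T := {q : V -> R | sublinear q /\ forall x, q x <= p x}.
pose below (q r : T) := `[< forall x, sval r x <= sval q x >].
have [||||[q [qs qp]] qmin] := @Zorn T below.
- by move=> q; apply/asboolP.
- move=> r s t /asboolP rs /asboolP st; apply/asboolP => x.
  exact: le_trans (st x) (rs x).
- move=> [r rP] [s sP] /asboolP /= rs /asboolP /= sr; apply: eq_exist => /=.
  by apply/funext => x; apply/eqP; rewrite eq_le rs sr.
- move=> A Atot; have [->|/set0P[q0 Aq0]] := eqVneq A set0.
    by exists (exist _ p (conj ps (fun x => lexx _))).
  have lbA x : has_lbound [set sval q x | q in A].
    exists (- p (- x)) => _ [[q [qs qp]] _ <-] /=.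
    by apply: le_trans (sublinear_geN _ _ qs); rewrite lerN2.
  have ms : sublinear (fun x => inf [set sval q x | q in A]).
    apply: sublinear_inf => [|//|q r x y Aq Ar|q a x Aq a0].
    - by exists q0.
    - have [/asboolP qr|/asboolP rq] := Atot q r Aq Ar.
      + exists r => //; apply: le_trans ((svalP r).1.1 x y) _.
        by rewrite lerD2r.
      + exists q => //; apply: le_trans ((svalP q).1.1 x y) _.
        by rewrite lerD2l.
    - by exists q => //; exact: (svalP q).1.2.
  have mle (q : T) x : A q -> inf [set sval q x | q in A] <= sval q x.
    by move=> Aq; apply: ge_inf => //; exists q.
  have mp x : inf [set sval q x | q in A] <= p x.
    exact: le_trans (mle q0 x Aq0) ((svalP q0).2 x).
  pose m : T := exist _ (fun x => inf [set sval q x | q in A]) (conj ms mp).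
  exists m => q Aq; apply/asboolP => x; exact: mle.
exists q; split=> // r rs rq.
have rp x : r x <= p x by exact: le_trans (rq x) (qp x).
have := qmin (exist _ r (conj rs rp) : T) (introT (asboolP _) rq).
by move=> /(congr1 sval).
Qed.

(** Shearing a minimal [q] along [x] cannot lower it, whence
    [q (- x) <= - q x]: [q] is odd, and odd sublinear functionals are linear. *)
Lemma minimal_sublinear_linear q : sublinear q ->
  (forall r, sublinear r -> (forall x, r x <= q x) -> r = q) ->
  linear (q : V -> R^o).
Proof.
move=> qs qmin.
have qN x : q (- x) = - q x.
  have sq : shear q x = q.
    by apply: qmin; [exact: sublinear_shear|move=> y; exact: shear_self].
  have := shearN _ x qs; rewrite sq; have := sublinear_geN _ x qs; lra.
have qD x y : q (x + y) = q x + q y.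
  have := qs.1 x y; have := qs.1 (- x) (- y).
  rewrite -opprD !qN; lra.
move=> a x y; rewrite qD; congr (_ + _).
have [a0|/ltW a0] := leP 0 a; first exact: sublinearZ.
suff -> : q (a *: x) = a * q x by [].
by rewrite -{1}[a]opprK scaleNr qN sublinearZ ?oppr_ge0// mulNr opprK.
Qed.

(** The Hahn-Banach theorem. Starting the descent from the shear of [p] along
    [v], rather than from [p], forces the value [p v] at [v]. *)
Lemma sublinear_support p v : sublinear p ->
  exists L : V -> R^o, [/\ linear L, forall x, L x <= p x & L v = p v].
Proof.
move=> ps.
have [L [Ls Lp Lmin]] := minimal_sublinear _ (sublinear_shear _ v ps).
have Ll := minimal_sublinear_linear _ Ls Lmin.
have Lep x : L x <= p x by exact: le_trans (Lp x) (shear_self _ _ _ ps).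
exists L; split=> //; apply/eqP; rewrite eq_le Lep/=.
have := sublinear_geN _ v Ls; have := le_trans (Lp (- v)) (shearN _ v ps); lra.
Qed.

End sublinear.

(** * Separating a point from a closed subspace *)

Lemma dual_of_normle {R : realType} {V : normedModType R} (L : V -> R^o) :
  linear L -> (forall x, `|L x| <= `|x|) -> L \in @dualp R V.
Proof.
move=> Ll Lle; apply/asboolP; split=> //.
pose Ladd := GRing.isLinear.Build R V R^o *:%R L Ll.
pose LL : {linear V -> R^o} := HB.pack L Ladd.
apply: (@bounded_linear_continuous _ _ _ LL).
by apply/bounded_funP => r; exists r => x xr; apply: le_trans (Lle x) xr.
Qed.

Section distance.
Context {R : realType} {V : normedModType R} (S : submodClosed V).

Definition distance_to (x : V) : R :=
  inf [set `|x - s| | s in [set s : V | s \in S]].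

Lemma distance_to_le (x s : V) : s \in S -> distance_to x <= `|x - s|.
Proof.
move=> Ss; apply: ge_inf; last by exists s.
by exists 0 => _ [t _ <-].
Qed.

Lemma sublinear_distance_to : sublinear distance_to.
Proof.
apply: (sublinear_inf _ _ (fun s x => `|x - s|)).
- by exists 0; exact: rpred0.
- by move=> x; exists 0 => _ [t _ <-].
- move=> s t x y /= Ss St; exists (s + t); first exact: rpredD.
  by rewrite opprD addrACA ler_normD.
- move=> s a x /= Ss a0; exists (a *: s); first exact: rpredZ.
  by rewrite -scalerBr normrZ ger0_norm.
Qed.

Lemma distance_to_gt0 (x : V) : closed [set s : V | s \in S] -> x \notin S ->
  0 < distance_to x.
Proof.
move=> Sc xS; rewrite ltNge; apply/negP => d0; move/negP: xS; apply.
apply: Sc => /= B /nbhs_ballP[e /= e0 eB].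
have [|_ [s Ss <-] se] :=
    @inf_adherent _ [set `|x - s| | s in [set s : V | s \in S]] e e0.
  split; first by exists `|x - 0|; exists 0 => //; exact: rpred0.
  by exists 0 => _ [t _ <-].
exists s; split=> //; apply: eB; rewrite -ball_normE /=.
by move: d0; rewrite /distance_to; lra.
Qed.

(** A linear functional below the distance to [S] is nonpositive on [S], hence
    null there, and is continuous because the distance to [S] is at most the
    norm. *)
Lemma closed_submodule_separation (v : V) :
  closed [set s : V | s \in S] -> v \notin S ->
  exists L : dual V, (forall s, s \in S -> L s = 0) /\ L v = 1.
Proof.
move=> Sc vS; have d0 := distance_to_gt0 _ Sc vS.
have [L [Ll Ld Lv]] := sublinear_support _ v sublinear_distance_to.
pose Ladd := GRing.isLinear.Build R V R^o *:%R L Ll.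
pose LL : {linear V -> R^o} := HB.pack L Ladd.
have LN x : L (- x) = - L x by exact: (linearN LL).
have Lle x : L x <= `|x|.
  by apply: le_trans (Ld x) _; rewrite -{2}[x]subr0 distance_to_le ?rpred0.
have Lnorm x : `|L x| <= `|x|.
  by rewrite ler_norml Lle andbT lerNl -LN -normrN Lle.
pose D : dual V := Sub L (dual_of_normle _ Ll Lnorm).
have DZ (a : R) x : (a *: D : dual V) x = a * L x by [].
exists ((distance_to v)^-1 *: D); split=> [s Ss|]; rewrite DZ; last first.
  by rewrite Lv mulVf// gt_eqF.
have L0 t : t \in S -> L t <= 0.
  move=> St; apply: le_trans (Ld t) _.
  by have := distance_to_le t t St; rewrite subrr normr0.
suff -> : L s = 0 by rewrite mulr0.
apply/eqP; rewrite eq_le L0//= -oppr_le0 -LN L0//.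
by rewrite -scaleN1r rpredZ.
Qed.

End distance.

(** * Functions of states *)

Section states.
Context {R : realType} {V : normedModType R}.

Lemma dual_norm1_le (Q : dual V) (v : V) : dual_norm Q = 1 -> `|Q v| <= `|v|.
Proof.
move=> Q1.
(* The supremum of an unbounded set is 0 by convention, so norm 1 entails
   boundedness. *)
have Qub : has_ubound [set `|Q v| | v in [set v : V | `|v| <= 1]].
  apply: contrapT => Qub; have Q0 : dual_norm Q = 0 by apply: sup_out; case.
  by have := oner_neq0 R; rewrite -Q1 Q0 eqxx.
have [->|v0] := eqVneq v 0; first by rewrite linear0 !normr0.
rewrite -[leRHS]mulr1 -ler_pdivrMl ?normr_gt0//.
rewrite -[leLHS]ger0_norm ?mulr_ge0 ?invr_ge0//.
rewrite normrM normr_id -normrM.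
have -> : `|v|^-1 * Q v = Q (`|v|^-1 *: v) by rewrite linearZ.
rewrite -Q1; apply: ub_le_sup => //; exists (`|v|^-1 *: v) => //=.
by rewrite normrZ ger0_norm ?invr_ge0// mulVf// normr_eq0.
Qed.

Lemma dual_eval_continuous (v : V) : continuous (fun Q : dual V => Q v : R^o).
Proof.
pose val_ptws : dual V -> {ptws V -> R^o} := @dual_val R V.
move=> Q; have vc : val_ptws @ nbhs Q --> val_ptws Q.
  exact: (@initial_continuous _ _ val_ptws Q).
have pc : (fun g : {ptws V -> R^o} => g v) @ nbhs (val_ptws Q) --> val_ptws Q v.
  exact: (@proj_continuous V (fun=> R^o) v (val_ptws Q)).
exact: (cvg_comp _ _ vc pc).
Qed.

Lemma convex_function_eval (A : set (dual V)) (v : V) :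
  convex_function A (fun Q : dual V => Q v : R^o).
Proof. by move=> t P Q _ _. Qed.

Lemma convex_function_cst (A : set (dual V)) (c : R) :
  convex_function A (fun=> c : R^o).
Proof. by move=> t P Q _ _; rewrite convmm. Qed.

End states.

(** * The envelope of a continuous function *)

Section envelope.
Context {R : realType} {K : ptopologicalType} {hK : compact [set: K]}.
Local Notation C := (contfun R hK).
Implicit Types (f : C) (x : K) (c : R).

Lemma radon_dirac x : radon (\d_(x : borel K) : probability (borel K) R).
Proof.
move=> A _; apply/eqP; rewrite eq_le; apply/andP; split; last first.
  apply: ge_ereal_sup => _ [B [_ BA] <-].
  rewrite [leLHS]diracE [leRHS]diracE lee_fin ler_nat.
  by have [/set_mem/BA/mem_set ->|] := boolP (x \in B).
have [xA|xA] := pselect (A x); last first.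
  rewrite [leLHS]diracE memNset//.
  apply: ereal_sup_ubound; exists set0; last exact: measure0.
  by split; first exact: compact0.
apply: ereal_sup_ubound; exists [set x]; first split.
- exact: compact_set1.
- by move=> _ ->.
- by rewrite /= !diracE !mem_set.
Qed.

Lemma radon_probability_dirac x : radon_probability (dirac_functional R hK x).
Proof. by exists (\d_(x : borel K)); [exact: radon_dirac|]. Qed.

Lemma radon_probability_ge (mu : dual C) f c :
  radon_probability mu -> (forall x, c <= f x) -> c <= mu f.
Proof.
move=> [P _ <-] cf; rewrite [leRHS]/(\int[P]_x f x).
have <- : \int[P]_(x in [set: borel K]) (cst c) x = c.
  by rewrite Rintegral_cst// [X in fine X](probability_setT P) mulr1.
apply: le_Rintegral => //.
- exact: (contfun_integrable P (contfun_cst hK c)).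
- exact: contfun_integrable.
Qed.

(** The half-space above [c - 1] contains each slab, since a Radon probability
    gives [f] at least the value [c], and it is convex. *)
Lemma slab_hull_gt (nu : dual C) f c :
  (forall x, c <= f x) -> slab_hull f nu -> c - 1 < nu f.
Proof.
move=> cf; suff: slab_hull f `<=` [set nu : dual C | c - 1 < nu f] by exact.
apply: smallest_sub.
- have conv_gt (b u v t : R) :
      b < u -> b < v -> 0 < t -> t < 1 -> b < t * u + (1 - t) * v by nra.
  apply/convex_setW => P Q; rewrite !inE => cP cQ t t0 t1; rewrite inE.
  exact: conv_gt cP cQ t0 t1.
- move=> P [mu muP Pmu]; have := radon_probability_ge _ _ _ muP cf.
  have : `|P f - mu f : R| < 1 by exact: Pmu.
  by move=> /ltr_normlP [? _] /= ?; lra.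
Qed.

Lemma slab_subset_hull (mu : dual C) f :
  radon_probability mu -> slab mu f `<=` slab_hull f.
Proof. by move=> muP nu munu; apply: sub_gen_smallest; exists mu. Qed.

Context (Phi : submodClosed C).

Lemma hat_subspace f : f \in Phi -> hat Phi f = f.
Proof.
move=> fPhi; apply/funext => x; rewrite /hat.
rewrite (_ : [set _ | _ in _] = [set (f x : R)]) ?inf1//.
apply/seteqP; split=> [_ [nu [/(_ f fPhi) <- _] <-]|_ ->].
  by rewrite dirac_functionalE.
exists (dirac_functional R hK x); last exact: dirac_functionalE.
split=> //; apply: slab_subset_hull (radon_probability_dirac x) _ _.
by rewrite /slab /= subrr normr0.
Qed.

(** Adding multiples of a functional that vanishes on [Phi] but not at [f] moves
    a measure inside its class while giving [f] an arbitrary value; those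
    within 1 of the minimum of [f] are admitted by the slab of the Dirac
    measure at a minimum point. *)
Lemma hat_notin_subspace f (y : K) :
    closed [set phi : C | phi \in Phi] -> f \notin Phi ->
  (forall x, f y <= f x) -> hat Phi f = fun=> f y - 1.
Proof.
move=> Phic fPhi fy; apply/funext => x; rewrite /hat.
have [L [L0 L1]] := closed_submodule_separation Phi f Phic fPhi.
set E := [set _ | _ in _].
have lbE : lbound E (f y - 1).
  by move=> _ [nu [_ nuf] <-]; apply/ltW/slab_hull_gt.
have Ein c : `|c - f y| < 1 -> E c.
  move=> cy; pose nu : dual C := dirac_functional R hK x + (c - f x) *: L.
  have nuE (g : C) : nu g = (g x : R) + (c - f x) * (L g : R).
    by rewrite -[X in X + _](dirac_functionalE x g).
  have nuf : nu f = c by rewrite nuE L1 mulr1 subrKC.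
  exists nu => //; split=> [phi Phiphi|].
    by rewrite nuE L0// mulr0 addr0 dirac_functionalE.
  apply: slab_subset_hull (radon_probability_dirac y) _ _.
  have fE : (nu - dirac_functional R hK y : dual C) f = c - f y :> R.
    by rewrite -(dirac_functionalE y f) -nuf.
  by rewrite /slab /= fE.
apply/eqP; rewrite eq_le; apply/andP; split; last first.
  apply: lb_le_inf => //; exists (f y); apply: Ein.
  by rewrite subrr normr0.
apply/ler_addgt0Pr => e e0.
(* The cap at 1 keeps f y - 1 + d within distance 1 of f y. *)
pose d := Num.min e 1.
have [d0 de d1] : [/\ 0 < d, d <= e & d <= 1].
  by rewrite /d lt_min e0 ltr01 !ge_min !lexx orbT.
apply: le_trans (_ : f y - 1 + d <= _); last by rewrite lerD2l.
apply: ge_inf; first by exists (f y - 1).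
apply: Ein; rewrite ltr_norml; apply/andP; split; lra.
Qed.

End envelope.

Theorem theorem11 (R : realType) (K : ptopologicalType)
    (K_compact : compact [set: K]) (K_hausdorff : hausdorff_space K)
    (Phi : submodClosed (contfun R K_compact))
    (Phi_closed : closed [set phi : contfun R K_compact | phi \in Phi])
    (Phi_separates : forall x y : K, x <> y ->
       exists2 phi : contfun R K_compact, phi \in Phi & phi x <> phi y)
    (Phi_constants : forall c : R, contfun_cst K_compact c \in Phi)
    (f : contfun R K_compact) :
  exists F : dual (normed_subspace Phi) -> R^o,
    [/\ convex_function (state_space (Phi_constants 1)) F,
        {within state_space (Phi_constants 1), continuous F},
        hat Phi f = F \o injection Phi,
        convex_trace (Phi_constants 1) (hat Phi f) &
        forall Q : dual (normed_subspace Phi),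
          state_space (Phi_constants 1) Q -> - (`|f| + 1) <= F Q <= `|f|].
Proof.
suff [F [Fconv Fcont hatF Fle]] :
  exists F : dual (normed_subspace Phi) -> R^o,
    [/\ convex_function (state_space (Phi_constants 1)) F,
        {within state_space (Phi_constants 1), continuous F},
        hat Phi f = F \o injection Phi &
        forall Q : dual (normed_subspace Phi),
          state_space (Phi_constants 1) Q -> - (`|f| + 1) <= F Q <= `|f|].
  by exists F; split=> //; exists F.
have fle x : - `|f| <= f x <= `|f| by rewrite -ler_norml; exact: le_supnorm.
have [fPhi|fPhi] := boolP (f \in Phi).
  pose phi : normed_subspace Phi := Sub f fPhi.
  exists (fun Q => Q phi); split.
  - exact: convex_function_eval.
  - by apply: continuous_subspaceT; exact: dual_eval_continuous.
  - by rewrite hat_subspace.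
  - move=> Q [Q1 _]; have : `|Q phi| <= `|f| by exact: dual_norm1_le.
    by rewrite ler_norml => /andP[]; lra.
have [y _ fy] : exists2 y, y \in [set: K] &
    forall x, x \in [set: K] -> f y <= f x.
  apply: compact_EVT_min => //; first by exists point.
  by apply: continuous_subspaceT; exact: contfun_continuous.
exists (fun=> f y - 1); split.
- exact: convex_function_cst.
- by apply: continuous_subspaceT; exact: cst_continuous.
- by apply: hat_notin_subspace => // x; apply: fy; rewrite inE.
- by move=> Q _; have /andP[] := fle y; lra.
Qed.
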